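(* The operator $\mathcal{L}_p=\mathcal{L}_p(x_1,\dots,x_p;\beta_0,\dots,\beta_{p+1};N)$ is triangular. More precisely, for every $d\in\mathbb{N}_0$, $$\mathcal{L}_p(q)\equiv-d\,(d-1+\beta_{p+1}-\beta_0)\,q\mod \mathcal{P}_\lambda^{d-1}\qquad\text{for every }q\in\mathcal{P}_\lambda^d.$$
   Context: Notation: $p\ge1$, $x=(x_1,\dots,x_p)$, real parameters $\beta_0,\dots,\beta_{p+1},N$. Put $\lambda_i=x_i(x_i+\beta_i)$ for $1\le i\le p$, $\mathcal{P}_\lambda=\mathbb{R}[\lambda_1,\dots,\lambda_p]\subset\mathbb{R}[x_1,\dots,x_p]$, and let $\mathcal{P}_\lambda^d$ be the space of elements of $\mathcal{P}_\lambda$ of total degree at most $d$ in $\lambda_1,\dots,\lambda_p$, with $\mathcal{P}_\lambda^{-1}=\{0\}$. A linear operator $L$ on $\mathcal{P}_\lambda$ is called triangular if for every $d\in\mathbb{N}_0$ there is $c_d\in\mathbb{R}$ such that $L(q)\equiv c_dq\mod\mathcal{P}_\lambda^{d-1}$ for all $q\in\mathcal{P}_\lambda^d$. The operator $\mathcal{L}_p$: $E_{x_i}$ is the shift $f(x)\mapsto f(x+e_i)$, $\triangle_{x_i}=E_{x_i}-1$, $\nabla_{x_i}=1-E_{x_i}^{-1}$, with multi-index notation $\triangle_x^\mu=\prod_j\triangle_{x_j}^{\mu_j}$, $\nabla_x^\mu=\prod_j\nabla_{x_j}^{\mu_j}$. Let $I_i$ be the substitution $x_i\mapsto -x_i-\beta_i$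 (other variables fixed) on rational functions. For $\nu\in\{0,1\}^p\setminus\{0\}$ with nonzero components at positions $i_1<\cdots<i_s$ put $$A_\nu=(x_{i_1}+\beta_{i_1}-\beta_0)(x_{i_1}+\beta_{i_1})\,\frac{\prod_{k=2}^s(x_{i_k}+x_{i_{k-1}}+\beta_{i_k})(x_{i_k}+x_{i_{k-1}}+\beta_{i_k}+1)}{\prod_{k=1}^s(2x_{i_k}+\beta_{i_k})(2x_{i_k}+\beta_{i_k}+1)}\,(x_{i_s}+\beta_{p+1}+N)(N-x_{i_s}).$$ For $\nu\in\mathbb{Z}^p$ put $\nu_j^+=\max(\nu_j,0)$, $\nu_j^-=-\min(\nu_j,0)$. For $\nu\in\{-1,0,1\}^p\setminus\{0,1\}^p$ put $A_\nu=I^{\nu^-}(A_{\nu^++\nu^-})$, where $I^{\nu^-}$ is the composition of the $I_i$ with $\nu_i^-=1$. Then $$\mathcal{L}_p=\sum_{\nu\in\{-1,0,1\}^p\setminus\{0\}}(-1)^{|\nu^-|}A_\nu\,\triangle_x^{\nu^+}\nabla_x^{\nu^-}.$$ *)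

(* Defs.v *)
From HB Require Import structures.
From mathcomp Require Import all_boot all_order all_algebra.
From mathcomp Require Import reals.
From mathcomp Require Import mpoly.

Set Implicit Arguments.
Unset Strict Implicit.
Unset Printing Implicit Defensive.

Import Order.TTheory GRing.Theory Num.Theory.
Local Open Scope ring_scope.

(* Index shift: the index i : 'I_p stands for the 1-based index i.+1, so the
   variable 'X_i goes with the parameter beta i.+1.  Parameters are given as a
   sequence beta : nat -> R, of which only beta 0, ..., beta p.+1 are used. *)

Notation ratfun R p := {fraction {mpoly R[p]}}.

Section RationalFunctions.
Variables (R : realType) (p : nat).
Local Notation K := (ratfun R p).
Implicit Types (f : K) (i : 'I_p) (mu : 'I_p -> nat).

Definition cst (c : R) : K := tofrac (c%:MP_[p]).
Definition x_ i : K := tofrac ('X_i : {mpoly R[p]}).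

(* f(s_1, ..., s_p), computed on a numerator and a denominator of f.  This does
   not depend on their choice as soon as q |-> q \mPo s is injective, which is
   the case for the invertible affine substitutions used below. *)
Definition ratsubst (s : p.-tuple {mpoly R[p]}) f : K :=
  tofrac (\n_(repr f) \mPo s) / tofrac (\d_(repr f) \mPo s).

Definition shift (c : R) i : K -> K :=
  ratsubst [tuple if j == i then 'X_j + c%:MP else 'X_j | j < p].

Definition reflect_var (beta : nat -> R) i : K -> K :=
  ratsubst [tuple if j == i then - 'X_j - (beta j.+1)%:MP else 'X_j | j < p].

Definition fwd_diff i f : K := shift 1 i f - f.
Definition bwd_diff i f : K := f - shift (-1) i f.

Definition fwd_diffs mu : K -> K :=
  \big[comp/id]_(i < p) iter (mu i) (fwd_diff i).
Definition bwd_diffs mu : K -> K :=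
  \big[comp/id]_(i < p) iter (mu i) (bwd_diff i).

End RationalFunctions.

Arguments cst {R p} c.
Arguments x_ {R p} i.

Section IntegerVectors.
Variable p : nat.
Implicit Types nu : 'I_p -> int.

Definition pos_part nu (i : 'I_p) : nat := `|Num.max (nu i) 0|%N.
Definition neg_part nu (i : 'I_p) : nat := `|Num.min (nu i) 0|%N.
Definition weight (mu : 'I_p -> nat) : nat := (\sum_(i < p) mu i)%N.

(* {ffun 'I_p -> 'I_3} enumerates {-1,0,1}^p, with 0, 1, 2 : 'I_3 encoding
   -1, 0, 1. *)
Definition signs (t : {ffun 'I_p -> 'I_3}) : 'I_p -> int :=
  fun i => (t i : nat)%:Z - 1.

End IntegerVectors.

Section Operator.
Variables (R : realType) (p : nat) (beta : nat -> R) (N : R).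
Local Notation K := (ratfun R p).

(* A_nu for nu in {0,1}^p with nonzero components exactly at the positions
   listed, in increasing order, in i1 :: s; the pairs (j, k) below are the
   pairs (i_{k-1}, i_k) of consecutive positions. *)
Definition A_support (i1 : 'I_p) (s : seq 'I_p) : K :=
  let b (i : 'I_p) : K := cst (beta i.+1) in
  let il := last i1 s in
  (x_ i1 + b i1 - cst (beta 0)) * (x_ i1 + b i1)
  * ((\prod_(jk <- zip (i1 :: s) s)
        ((x_ jk.2 + x_ jk.1 + b jk.2) * (x_ jk.2 + x_ jk.1 + b jk.2 + 1)))
     / (\prod_(k <- i1 :: s)
          ((2 * x_ k + b k) * (2 * x_ k + b k + 1))))
  * (x_ il + cst (beta p.+1) + cst N) * (cst N - x_ il).

Definition A_nonneg (mu : 'I_p -> nat) : K :=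
  if [seq i <- enum 'I_p | mu i != 0%N] is i1 :: s then A_support i1 s else 0.

(* For nu in {0,1}^p the composition of reflections is empty and this is
   A_nonneg nu. *)
Definition A_coef (nu : 'I_p -> int) : K :=
  (\big[comp/id]_(i < p | neg_part nu i == 1%N) reflect_var beta i)
    (A_nonneg (fun i => pos_part nu i + neg_part nu i)%N).

Definition Lop (f : K) : K :=
  \sum_(t : {ffun 'I_p -> 'I_3} | [exists i, signs t i != 0])
    (-1) ^+ weight (neg_part (signs t)) * A_coef (signs t)
    * fwd_diffs (pos_part (signs t)) (bwd_diffs (neg_part (signs t)) f).

End Operator.

Section LambdaPolynomials.
Variables (R : realType) (p : nat) (beta : nat -> R).
Local Notation K := (ratfun R p).
Implicit Types (f q : K) (L : K -> K) (d : int).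

Definition lambdas : p.-tuple {mpoly R[p]} :=
  [tuple 'X_i * ('X_i + (beta i.+1)%:MP) | i < p].

Definition in_Plambda f : Prop :=
  exists g : {mpoly R[p]}, f = tofrac (g \mPo lambdas).

(* msize g is the total degree of g plus one, and msize 0 = 0; in particular
   in_Plambda_deg (-1) f means f = 0. *)
Definition in_Plambda_deg d f : Prop :=
  exists2 g : {mpoly R[p]}, (msize g)%:Z <= d + 1 & f = tofrac (g \mPo lambdas).

Definition eqmod_Plambda d (f1 f2 : K) : Prop := in_Plambda_deg d (f1 - f2).

Definition linear_operator_on_Plambda L : Prop :=
  (forall q, in_Plambda q -> in_Plambda (L q)) /\
  (forall (c : R) (q1 q2 : K), in_Plambda q1 -> in_Plambda q2 ->
     L (cst c * q1 + q2) = cst c * L q1 + L q2).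

Definition triangular L : Prop :=
  linear_operator_on_Plambda L /\
  forall d : nat, exists c : R, forall q, in_Plambda_deg d%:Z q ->
    eqmod_Plambda (d%:Z - 1) (L q) (cst c * q).

End LambdaPolynomials.

(* Main.v *)
Require Import Defs.
From HB Require Import structures.
From mathcomp Require Import all_boot all_order all_algebra.
From mathcomp Require Import reals.
From mathcomp Require Import mpoly ring zify.

Set Implicit Arguments.
Unset Strict Implicit.
Unset Printing Implicit Defensive.

Import Order.TTheory GRing.Theory Num.Theory.
Local Open Scope ring_scope.

(** Write I_j for the reflection x_j |-> - x_j - beta_j, under which lambda_j
is invariant, and let S be the support of nu.  Since I_j o Delta_j =
- nabla_j o I_j and A_nu is a reflection of A_S, the term of index nu applied
to q in P_lambda is the reflection of A_S * Delta^S q in the negative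
directions of nu.  Grouping the sign vectors nu by their support gives
[Lop_lam]:
    L q = \sum_(S != 0) \prod_(j in S) (1 + I_j) (A_S * Delta^S q).

Take q = lambda^m.  The increment Delta_j lambda_j = 2 x_j + beta_j + 1
divides Delta_j lambda_j^(m_j), which cancels half of the denominator of A_S,
and there remains F_S / \prod_(j in S) (2 x_j + beta_j) with a polynomial F_S.
Its symmetrization is the iterated divided difference
    F |-> (F - I_j F) / (2 x_j + beta_j)   (j in S)
of F_S.  On powers of x_j this operator is a Lucas type recurrence in lambda_j
([power_quot]), so it maps polynomials in x to polynomials in lambda, and it
lowers the degree in x by one for each j in S ([divsymm_deg]), where lambda_j
has degree 2.

The part of F_S in the variables of S has degree at most 2 |m_S| + 2, where
m_S is the restriction of m to S.  So for |S| >= 3 the contribution of S has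
degree at most 2 |m| - 1 in x, hence degree less than |m| in lambda.  For
|S| = 1 and |S| = 2 the top degree of F_S consists of even powers, which the
divided difference kills, and of a term whose divided difference is a multiple
of lambda^m ([lead_term1], [lead_term2]).  The multiples are
- m_i (m_i - 1 + beta_(p+1) - beta_0) and - 2 m_i m_j, and their sum over all S
is - |m| (|m| - 1 + beta_(p+1) - beta_0) because |m|^2 is the sum of the m_i^2
and of the 2 m_i m_j ([sum_lead_coefS]). *)

(** * Substitutions in rational functions *)
Section FractionRepr.
Import FracField.
Local Open Scope quotient_scope.
Lemma frac_numden (D : idomainType) (f : {fraction D}) :
  f = tofrac \n_(repr f) / tofrac \d_(repr f).
Proof.
have d0 := denom_ratioP (repr f).
rewrite -[LHS]reprK -[X in \pi X]Ratio_numden.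
apply: (canRL (mulfK _)); first by rewrite tofrac_eq0.
rewrite !piE /=.
apply/eqmodP; rewrite /= /equivf !numden_Ratio ?mulr1 ?oner_neq0 //.
by rewrite mulrC.
Qed.

Lemma frac_ratio (D : idomainType) (f : {fraction D}) :
  exists2 nd : D * D, nd.2 != 0 & f = tofrac nd.1 / tofrac nd.2.
Proof.
exists (frac (repr f)); [exact: denom_ratioP | exact: frac_numden].
Qed.
End FractionRepr.

Lemma frac_eqP (D : idomainType) (a b c d : D) : b != 0 -> d != 0 ->
  reflect (tofrac a / tofrac b = tofrac c / tofrac d) (a * d == c * b).
Proof.
move=> b0 d0; rewrite -tofrac_eq !tofracM -eqr_div ?tofrac_eq0 //.
exact: eqP.
Qed.

Section Substitution.
Variables (R : realType) (p : nat).
Local Notation K := (ratfun R p).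
Implicit Types (s r : p.-tuple {mpoly R[p]}) (f g : K) (i j : 'I_p).

Lemma comp_mpoly_retract s r : (forall i, tnth s i \mPo r = 'X_i) ->
  forall q : {mpoly R[p]}, (q \mPo s) \mPo r = q.
Proof.
move=> sr q; rewrite (comp_mpolyEX q) raddf_sum [RHS]mpolyE /=.
apply: eq_bigr => m _; rewrite comp_mpolyZ comp_mpolyX rmorph_prod /=.
rewrite [in RHS]mpolyXE_id; congr (_ *: _).
by apply: eq_bigr => i _; rewrite rmorphXn /= sr.
Qed.

Lemma comp_mpoly_retract_inj s r : (forall i, tnth s i \mPo r = 'X_i) ->
  injective (comp_mpoly s : {mpoly R[p]} -> {mpoly R[p]}).
Proof. by move=> sr; exact: can_inj (comp_mpoly_retract sr). Qed.

Lemma comp_mpolyM s : {morph (comp_mpoly s : {mpoly R[p]} -> {mpoly R[p]}) : a b / a * b}.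
Proof. by move=> a b; rewrite rmorphM. Qed.

Section Injective.
Variable s : p.-tuple {mpoly R[p]}.
Hypothesis s_inj : injective (comp_mpoly s : {mpoly R[p]} -> {mpoly R[p]}).

Lemma comp_mpoly_inj_eq0 q : (q \mPo s == 0) = (q == 0).
Proof. by rewrite -[RHS](inj_eq s_inj) comp_mpoly0. Qed.

(** The chosen numerator and denominator of a fraction satisfy the same cross
product relation as any other pair representing it, and composition with [s]
respects this relation; injectivity keeps the new denominator nonzero. *)
Lemma ratsubst_frac a b : b != 0 ->
  ratsubst s (tofrac a / tofrac b) = tofrac (a \mPo s) / tofrac (b \mPo s).
Proof.
move=> b0; rewrite /ratsubst.
have := denom_ratioP (repr (tofrac a / tofrac b)).
have := frac_numden (tofrac a / tofrac b).
move: (repr _) => r fE /= d0.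
apply/frac_eqP; rewrite ?comp_mpoly_inj_eq0 //.
by move/frac_eqP: fE => /(_ b0 d0)/eqP fE; rewrite -!comp_mpolyM fE.
Qed.

Lemma ratsubst_tofrac a : ratsubst s (tofrac a) = tofrac (a \mPo s).
Proof.
have := ratsubst_frac a (oner_neq0 _).
by rewrite comp_mpoly1 tofrac1 !divr1.
Qed.

Lemma ratsubst_zmod_morphism : zmod_morphism (ratsubst s).
Proof.
move=> f g; have [[a b] /= b0 ->] := frac_ratio f.
have [[c d] /= d0 ->] := frac_ratio g.
rewrite -mulNr -tofracN addf_div ?tofrac_eq0 // -!tofracM -tofracD.
rewrite !ratsubst_frac ?mulf_neq0 // comp_mpolyD !comp_mpolyM comp_mpolyN.
rewrite -mulNr -tofracN addf_div ?tofrac_eq0 ?comp_mpoly_inj_eq0 //.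
by rewrite -!tofracM -tofracD.
Qed.

Lemma ratsubst_monoid_morphism : monoid_morphism (ratsubst s).
Proof.
split; first by rewrite -tofrac1 ratsubst_tofrac comp_mpoly1.
move=> f g; have [[a b] /= b0 ->] := frac_ratio f.
have [[c d] /= d0 ->] := frac_ratio g.
rewrite mulf_div -!tofracM !ratsubst_frac ?mulf_neq0 // !comp_mpolyM.
by rewrite mulf_div -!tofracM.
Qed.

End Injective.
End Substitution.

Section Instances.
Variables (R : realType) (p : nat).
Local Notation K := (ratfun R p).
Implicit Types (i j : 'I_p).

Lemma shift_inj c i : injective (comp_mpoly
  [tuple if j == i then 'X_j + c%:MP else 'X_j | j < p] :
   {mpoly R[p]} -> {mpoly R[p]}).
Proof.
apply: (@comp_mpoly_retract_inj _ _ _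
  [tuple if j == i then 'X_j + (- c)%:MP else 'X_j | j < p]) => k.
rewrite tnth_mktuple; case: eqP => [->|/eqP/negPf ki].
  rewrite comp_mpolyD comp_mpolyC comp_mpolyXU -tnth_nth tnth_mktuple eqxx.
  by rewrite mpolyCN subrK.
by rewrite comp_mpolyXU -tnth_nth tnth_mktuple ki.
Qed.

Lemma reflect_inj (beta : nat -> R) i : injective (comp_mpoly
  [tuple if j == i then - 'X_j - (beta j.+1)%:MP else 'X_j | j < p] :
   {mpoly R[p]} -> {mpoly R[p]}).
Proof.
apply: (@comp_mpoly_retract_inj _ _ _
  [tuple if j == i then - 'X_j - (beta j.+1)%:MP else 'X_j | j < p]) => k.
rewrite tnth_mktuple; case: eqP => [->|/eqP/negPf ki].
  rewrite comp_mpolyB comp_mpolyN comp_mpolyC comp_mpolyXU -tnth_nth.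
  by rewrite tnth_mktuple eqxx opprD !opprK addrK.
by rewrite comp_mpolyXU -tnth_nth tnth_mktuple ki.
Qed.

HB.instance Definition _ c i := GRing.isZmodMorphism.Build K K (shift c i)
  (ratsubst_zmod_morphism (@shift_inj c i)).
HB.instance Definition _ c i := GRing.isMonoidMorphism.Build K K (shift c i)
  (ratsubst_monoid_morphism (@shift_inj c i)).
HB.instance Definition _ beta i :=
  GRing.isZmodMorphism.Build K K (reflect_var beta i)
  (ratsubst_zmod_morphism (@reflect_inj beta i)).
HB.instance Definition _ beta i :=
  GRing.isMonoidMorphism.Build K K (reflect_var beta i)
  (ratsubst_monoid_morphism (@reflect_inj beta i)).

HB.instance Definition _ :=
  GRing.isZmodMorphism.Build R K (@cst R p)
  (fun a b => etrans (congr1 (@tofrac _) (raddfB (@mpolyC p R) a b)) (tofracB _ _)).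
Lemma cst_monoid_morphism : monoid_morphism (@cst R p).
Proof. by split=> [|a b]; rewrite /cst ?rmorph1 // !rmorphM. Qed.
HB.instance Definition _ := GRing.isMonoidMorphism.Build R K (@cst R p) cst_monoid_morphism.

Lemma shift_x c i j :
  shift c i (x_ j) = if j == i then x_ j + cst c else x_ j :> K.
Proof.
rewrite /shift /x_ ratsubst_tofrac; last exact: shift_inj.
by rewrite comp_mpolyXU -tnth_nth tnth_mktuple; case: eqP => // _; rewrite tofracD.
Qed.

Lemma shift_cst c i a : shift c i (cst a) = cst a :> K.
Proof.
rewrite /shift /cst ratsubst_tofrac ?comp_mpolyC //; exact: shift_inj.
Qed.

Lemma reflect_x beta i j :
  reflect_var beta i (x_ j) =
    if j == i then - x_ j - cst (beta j.+1) else x_ j :> K.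
Proof.
rewrite /reflect_var /x_ ratsubst_tofrac; last exact: reflect_inj.
rewrite comp_mpolyXU -tnth_nth tnth_mktuple; case: eqP => // _.
by rewrite tofracB tofracN.
Qed.

Lemma reflect_cst beta i a : reflect_var beta i (cst a) = cst a :> K.
Proof.
rewrite /reflect_var /cst ratsubst_tofrac ?comp_mpolyC //; exact: reflect_inj.
Qed.
End Instances.

(** * Reflections and grouping of the terms by support *)

(** A composition of operators, each of which acts on one factor of a product
only, acts factorwise.  The hypothesis is asked of the products met along the
way, whose factors are in part already transformed. *)
Lemma big_comp_prod (A : comPzRingType) (I : finType) (phi : I -> A -> A)
    (f g : I -> A) :
  (forall i (h : I -> A), h i = f i -> (forall j, h j = f j \/ h j = g j) ->
     phi i (\prod_j h j) = g i * \prod_(j | j != i) h j) ->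
  (\big[comp/id]_i phi i) (\prod_j f j) = \prod_j g j.
Proof.
move=> phiP.
have partial r : uniq r -> (\big[comp/id]_(i <- r) phi i) (\prod_j f j)
    = \prod_j (if j \in r then g j else f j).
  elim: r => [_|i r IHr /= /andP[ir ur]]; first by rewrite big_nil.
  rewrite big_cons /= IHr // phiP ?(negPf ir) //; last first.
    by move=> j; case: ifP; [right | left].
  rewrite [RHS](bigD1 i) //= inE eqxx; congr (_ * _).
  by apply: eq_bigr => j ji; rewrite inE (negPf ji).
rewrite partial ?index_enum_uniq //.
by apply: eq_bigr => j _; rewrite mem_index_enum.
Qed.

Section Monomial.
Variables (R : realType) (p : nat) (beta : nat -> R).
Local Notation K := (ratfun R p).
Implicit Types (i j : 'I_p) (P : pred 'I_p) (t : {ffun 'I_p -> 'I_3}).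
Implicit Types (f g h : K) (S : {set 'I_p}) (m : 'I_p -> nat).

Definition reflects P : K -> K := \big[comp/id]_(i < p | P i) reflect_var beta i.

Lemma reflects_zmod_morphism P : zmod_morphism (reflects P).
Proof.
rewrite /reflects; elim/big_ind: _ => // [phi psi phiB psiB f g|i _ f g].
- by rewrite /= psiB phiB.
- exact: rmorphB.
Qed.

Lemma reflects_monoid_morphism P : monoid_morphism (reflects P).
Proof.
rewrite /reflects; elim/big_ind: _ => // [phi psi [p1 pM] [q1 qM]|i _].
- by split=> [|f g] /=; [rewrite q1 p1 | rewrite qM pM].
- by split; [exact: rmorph1 | exact: rmorphM].
Qed.

HB.instance Definition _ P :=
  GRing.isZmodMorphism.Build K K (reflects P) (reflects_zmod_morphism P).
HB.instance Definition _ P :=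
  GRing.isMonoidMorphism.Build K K (reflects P) (reflects_monoid_morphism P).

Lemma reflects_cst P a : reflects P (cst a) = cst a.
Proof.
rewrite /reflects; elim/big_ind: _ => // [phi psi e1 e2|i _] /=.
- by rewrite e2 e1.
- exact: reflect_cst.
Qed.

Lemma reflects_x P j :
  reflects P (x_ j) = if P j then - x_ j - cst (beta j.+1) else x_ j.
Proof.
rewrite /reflects.
rewrite [RHS](_ : _ = if (j \in index_enum 'I_p) && P j
  then - x_ j - cst (beta j.+1) else x_ j); last by rewrite mem_index_enum.
elim: (index_enum 'I_p) (index_enum_uniq 'I_p) => [_|i r IHr /= /andP[ir ur]].
  by rewrite big_nil.
rewrite big_cons inE; case: ifP => Pi /=; rewrite IHr //; first last.
  by case: (j =P i) => [->|//]; rewrite Pi andbF.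
case: (j =P i) => [->|/eqP/negPf ji] /=.
  by rewrite (negPf ir) Pi /= reflect_x eqxx.
by case: ifP; rewrite ?rmorphB ?rmorphN /= reflect_x ji ?reflect_cst.
Qed.

(** [lam j c] is lambda_j with x_j translated by c: the shifts and reflections
only move the parameter c, as lambda_j is invariant under I_j. *)
Definition lam j (c : R) : K := (x_ j + cst c) * (x_ j + cst c + cst (beta j.+1)).

Lemma shift_lam a i j c : shift a i (lam j c) = lam j (if j == i then c + a else c).
Proof.
rewrite /lam rmorphM !rmorphD /= !shift_cst shift_x; case: eqP => // _.
by rewrite [cst (c + a)]rmorphD; ring.
Qed.

Lemma reflects_lam P j c : reflects P (lam j c) = lam j (if P j then - c else c).
Proof.
rewrite /lam rmorphM !rmorphD /= !reflects_cst reflects_x; case: ifP => // _.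
by rewrite [cst (- c)]rmorphN; ring.
Qed.

Definition supp t : {set 'I_p} := [set i | t i != 1].

Lemma neg_part_signs t i : neg_part (signs t) i = (t i == 0).
Proof. by rewrite /neg_part /signs; case: (t i) => [[|[|[|?]]] ?]. Qed.
Lemma pos_part_signs t i : pos_part (signs t) i = (t i == 2%:R).
Proof. by rewrite /pos_part /signs; case: (t i) => [[|[|[|?]]] ?]. Qed.
Lemma signs_neq0 t i : (signs t i != 0) = (i \in supp t).
Proof. by rewrite inE /signs; case: (t i) => [[|[|[|?]]] ?]. Qed.

(** The factor in x_j of a term applied to lambda^m, with its sign: for t j = 0,
that is for a backward difference, it is minus that difference, which makes it
the reflection of the factor for t j = 2. *)
Definition diff_factor m t j : K :=
  lam j (if t j == 0 then -1 else if t j == 1 then 0 else 1) ^+ m j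
  - if t j == 1 then 0 else lam j 0 ^+ m j.

Lemma bwd_diffs_lam m t :
  bwd_diffs (neg_part (signs t)) (\prod_j lam j 0 ^+ m j)
  = \prod_j (if t j == 0 then lam j 0 ^+ m j - lam j (-1) ^+ m j else lam j 0 ^+ m j).
Proof.
apply: big_comp_prod => i h hi hP; rewrite neg_part_signs.
case: eqP => _ /=; last by rewrite (bigD1 i) //= hi.
rewrite /bwd_diff (bigD1 i) //= rmorphM /= hi rmorphXn /= shift_lam eqxx add0r.
rewrite (rmorph_prod (shift (-1) i)) mulrBl; congr (_ - _ * _).
apply: eq_bigr => j /negPf ji; case: (hP j) => ->; rewrite ?rmorphXn /= ?shift_lam ?ji //.
by case: eqP => _; rewrite ?rmorphB !rmorphXn /= !shift_lam ji.
Qed.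

Lemma fwd_bwd_diffs_lam m t :
  (-1) ^+ weight (neg_part (signs t)) *
  fwd_diffs (pos_part (signs t)) (bwd_diffs (neg_part (signs t)) (\prod_j lam j 0 ^+ m j))
  = \prod_j diff_factor m t j.
Proof.
rewrite bwd_diffs_lam /fwd_diffs.
rewrite (@big_comp_prod _ _ _ _ (fun j => (-1) ^+ (t j == 0) * diff_factor m t j)); last first.
  move=> i h hi hP; rewrite pos_part_signs /diff_factor.
  case: (t i =P 2%:R) => [ti|/eqP ti] /=; last first.
    rewrite (bigD1 i) //= hi; congr (_ * _).
    by case: (t i) ti => [[|[|[|?]]] ?] //= _; rewrite ?expr0 ?expr1 ?subr0 ?mul1r // mulN1r opprB.
  rewrite /fwd_diff (bigD1 i) //= rmorphM /= hi ti /= mul1r rmorphXn /= shift_lam eqxx add0r.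
  rewrite (rmorph_prod (shift 1 i)) mulrBl; congr (_ * _ - _).
  apply: eq_bigr => j /negPf ji; case: (hP j) => ->.
    by case: eqP => _; rewrite ?rmorphB !rmorphXn /= !shift_lam ji.
  rewrite rmorphM rmorphB !rmorphXn rmorphN1 /= shift_lam ji.
  by rewrite /diff_factor; case: (t j == 1); rewrite ?rmorph0 ?rmorphXn /= ?shift_lam ?ji.
rewrite big_split mulrA /= -[RHS]mul1r; congr (_ * _).
rewrite /weight (big_morph (fun n : nat => (-1 : K) ^+ n) (exprD _) (expr0 _)).
rewrite -big_split big1 //= => i _.
by rewrite neg_part_signs -expr2 sqrr_sign.
Qed.

(** This is \prod_(j in S) (1 + I_j), expanded. *)
Definition symm S h : K := \sum_(t | supp t == S) reflects (fun i => t i == 0) h.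

Definition A_set (N : R) S : K := A_nonneg beta N (fun i => i \in S : nat).

(** The reflections are ring morphisms that fix the lambda_j and exchange the
forward difference with minus the backward one, so each term is a reflection of
the term with the same support and no negative entry. *)
Lemma Lop_lam N m :
  Lop beta N (\prod_j lam j 0 ^+ m j) =
  \sum_(S : {set 'I_p} | S != set0)
    symm S (A_set N S * \prod_(j in S) (lam j 1 ^+ m j - lam j 0 ^+ m j))
    * \prod_(j in ~: S) lam j 0 ^+ m j.
Proof.
rewrite /Lop (partition_big supp (fun S => S != set0)) /=; last first.
  move=> t /existsP[i]; rewrite signs_neq0 => it; apply/set0Pn; by exists i.
apply: eq_bigr => S S0; rewrite /symm mulr_suml; apply: eq_big => [t|t /andP[_ /eqP tS]].
  apply/andP/idP => [[]//|/eqP tS]; split; last by apply/eqP.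
  by case/set0Pn: S0 => i; rewrite -tS -signs_neq0 => it; apply/existsP; exists i.
rewrite mulrAC fwd_bwd_diffs_lam mulrC.
rewrite /A_coef -[(\big[_/_]_(i | _) _) _]/(reflects _ _).
have -> : reflects (fun i => neg_part (signs t) i == 1%N) =1 reflects (fun i => t i == 0).
  move=> h; rewrite /reflects; congr (_ h); apply: eq_bigl => i.
  by rewrite neg_part_signs eqb1.
rewrite rmorphM -mulrA /=; congr (_ * _).
  congr (reflects _ _); rewrite /A_set /A_nonneg.
  suff -> : [seq i <- enum 'I_p | (pos_part (signs t) i + neg_part (signs t) i)%N != 0%N] =
    [seq i <- enum 'I_p | (i \in S : nat) != 0%N] by [].
  apply: eq_filter => i; rewrite -tS inE neg_part_signs pos_part_signs.
  by case: (t i) => [[|[|[|?]]] ?].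
rewrite (bigID (fun j => j \in S)) /= rmorph_prod /=; congr (_ * _).
  apply: eq_bigr => j; rewrite -tS inE /diff_factor => tj; rewrite (negPf tj).
  rewrite rmorphB !rmorphXn /= !reflects_lam oppr0 if_same; congr (lam _ _ ^+ _ - _).
apply: eq_big => [j|j]; rewrite ?inE // -tS inE negbK /diff_factor => /eqP ->.
by rewrite subr0.
Qed.

End Monomial.

(** * Degree and support of polynomials *)
Section DegSupp.
Variables (R : realType) (p : nat).
Implicit Types (F G : {mpoly R[p]}) (S : {set 'I_p}) (k l : int) (w : nat).

(** The variables get the weight [w]: 1 for polynomials in x, and 2 for
polynomials in lambda, so that both degrees are measured in x.  The bound is an
integer because remainders of degree at most -1, that is zero, occur. *)
Definition deg_supp S w k F := forall n, n \in msupp F ->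
  ((w * mdeg n)%N%:Z <= k) /\ (forall j, j \notin S -> n j = 0%N).

Lemma deg_supp_le S w k l F : k <= l -> deg_supp S w k F -> deg_supp S w l F.
Proof. by move=> kl Fk n /Fk[nk nS]; split=> //; apply: le_trans kl. Qed.

Lemma deg_supp0 S w k : deg_supp S w k 0.
Proof. by move=> n; rewrite msupp0. Qed.

Lemma deg_suppD S w k F G :
  deg_supp S w k F -> deg_supp S w k G -> deg_supp S w k (F + G).
Proof. by move=> Fk Gk n /msuppD_le; rewrite mem_cat => /orP[/Fk|/Gk]. Qed.

Lemma deg_suppN S w k F : deg_supp S w k F -> deg_supp S w k (- F).
Proof. by move=> Fk n; rewrite (perm_mem (msuppN F)) => /Fk. Qed.

Lemma deg_suppB S w k F G :
  deg_supp S w k F -> deg_supp S w k G -> deg_supp S w k (F - G).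
Proof. by move=> Fk Gk; apply/deg_suppD/deg_suppN. Qed.

Lemma deg_suppM S w k l F G :
  deg_supp S w k F -> deg_supp S w l G -> deg_supp S w (k + l) (F * G).
Proof.
move=> Fk Gl n /msuppM_le/allpairsP[[a b] /= [/Fk[ak aS] /Gl[bl bS] ->]].
split=> [|j jS]; first by rewrite mdegD; lia.
by rewrite mnmDE aS ?bS.
Qed.

Lemma deg_supp_prod (I : Type) (r : seq I) (P : pred I) S w (k : I -> int) (E : I -> {mpoly R[p]}) :
  (forall i, P i -> deg_supp S w (k i) (E i)) ->
  deg_supp S w (\sum_(i <- r | P i) k i) (\prod_(i <- r | P i) E i).
Proof.
move=> Fk; apply: (big_rec2 (fun l G => deg_supp S w l G)) => [n|i l G Pi Gl].
  by rewrite -mpolyC1 msupp1 inE => /eqP->; rewrite mdeg0 muln0; split=> // j; rewrite mnm0E.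
exact/deg_suppM/Gl/Fk.
Qed.

Lemma deg_suppC S w k c : 0 <= k -> deg_supp S w k c%:MP.
Proof.
move=> k0 n; rewrite msuppC; case: ifP => // _; rewrite inE => /eqP ->.
by rewrite mdeg0 muln0; split=> // j; rewrite mnm0E.
Qed.

Lemma deg_supp1 S w k : 0 <= k -> deg_supp S w k 1.
Proof. by move=> k0; rewrite -mpolyC1; apply: deg_suppC. Qed.

Lemma deg_suppX S w (k : int) j : j \in S -> w%:Z <= k -> deg_supp S w k 'X_j.
Proof.
move=> jS wk n; rewrite msuppX inE => /eqP ->; rewrite mdeg1 muln1; split=> // i.
by rewrite mnm1E; case: (j =P i) => // <-; rewrite jS.
Qed.

Lemma deg_suppXn S w k F e :
  deg_supp S w k F -> deg_supp S w (k * e%:Z) (F ^+ e).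
Proof.
move=> Fk; elim: e => [|e IHe]; first by rewrite mulr0; apply: deg_supp1.
rewrite exprS; apply: deg_supp_le _ (deg_suppM Fk IHe).
by lia.
Qed.

Lemma deg_suppCM S w k c F : deg_supp S w k F -> deg_supp S w k (c%:MP * F).
Proof.
move=> Fk; rewrite -[k]add0r; exact: deg_suppM (deg_suppC _ _ _) Fk.
Qed.

End DegSupp.

(** * Divided differences *)
Section Symmetrization.
Variables (R : realType) (p : nat) (beta : nat -> R).
Local Notation K := (ratfun R p).
Local Notation b i := (beta i.+1).
Local Notation symm := (symm beta).
Implicit Types (i j : 'I_p) (S : {set 'I_p}) (f h : K) (F G g : {mpoly R[p]}).
Implicit Types (k l : int).

(** A shift changes this element by 2, so it is not 0. *)
Lemma lin_neq0 j (c : R) : 2 * x_ j + cst c != 0 :> K.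
Proof.
apply/eqP => e0; have := congr1 (shift 1 j) e0.
rewrite rmorph0 rmorphD rmorphM rmorph_nat /= shift_x eqxx shift_cst.
rewrite mulrDr addrAC e0 add0r rmorph1 mulr1 => /eqP.
by rewrite -(rmorph_nat (@cst R p)) fmorph_eq0 pnatr_eq0.
Qed.

Lemma symm_zmod_morphism S : zmod_morphism (symm S).
Proof. by move=> f g; rewrite /symm -sumrB; apply: eq_bigr => t _; rewrite rmorphB. Qed.
HB.instance Definition _ S := GRing.isZmodMorphism.Build K K (symm S) (symm_zmod_morphism S).

Lemma symmZ S c h : symm S (cst c * h) = cst c * symm S h.
Proof.
rewrite /symm mulr_sumr; apply: eq_bigr => t _.
by rewrite rmorphM /= reflects_cst.
Qed.

(** As I_j changes the sign of 2 x_j + beta_j, this is the iterated divided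
difference (F - I_j F) / (2 x_j + beta_j) over j in S. *)
Definition divsymm S F : K := symm S (tofrac F / \prod_(j in S) (2 * x_ j + cst (b j))).

Lemma divsymm_zmod_morphism S : zmod_morphism (divsymm S).
Proof. by move=> F G; rewrite /divsymm tofracB mulrBl raddfB. Qed.
HB.instance Definition _ S :=
  GRing.isZmodMorphism.Build {mpoly R[p]} K (divsymm S) (divsymm_zmod_morphism S).

Lemma divsymmZ S c F : divsymm S (c *: F) = cst c * divsymm S F.
Proof. by rewrite /divsymm -mul_mpolyC tofracM -mulrA symmZ. Qed.

(** Substitution of the lambda_j, an isomorphism onto P_lambda. *)
Definition of_lambda (g : {mpoly R[p]}) : K := tofrac (g \mPo lambdas p beta).

Lemma of_lambda_zmod : zmod_morphism of_lambda.
Proof. by move=> f g; rewrite /of_lambda comp_mpolyB tofracB. Qed.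
Lemma of_lambda_monoid : monoid_morphism of_lambda.
Proof. by split=> [|f g]; rewrite /of_lambda ?comp_mpoly1 ?comp_mpolyM ?tofrac1 ?tofracM. Qed.
HB.instance Definition _ := GRing.isZmodMorphism.Build {mpoly R[p]} K of_lambda of_lambda_zmod.
HB.instance Definition _ := GRing.isMonoidMorphism.Build {mpoly R[p]} K of_lambda of_lambda_monoid.

Lemma of_lambda_X j : of_lambda 'X_j = lam beta j 0.
Proof.
rewrite /of_lambda comp_mpolyXU -tnth_nth tnth_mktuple tofracM tofracD.
by rewrite /lam rmorph0 addr0.
Qed.

Lemma of_lambda_C c : of_lambda c%:MP = cst c.
Proof. by rewrite /of_lambda comp_mpolyC. Qed.

Lemma reflects_of_lambda P g : reflects beta P (of_lambda g) = of_lambda g.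
Proof.
rewrite (mpolyE g) !rmorph_sum; apply: eq_bigr => n _ /=.
rewrite -mul_mpolyC !rmorphM /= of_lambda_C reflects_cst mpolyXE_id !rmorph_prod.
congr (_ * _); apply: eq_bigr => j _.
by rewrite /= !rmorphXn /= of_lambda_X reflects_lam oppr0 if_same.
Qed.

Lemma symm_of_lambda S g h : symm S (h * of_lambda g) = symm S h * of_lambda g.
Proof.
rewrite /symm mulr_suml; apply: eq_bigr => t _.
by rewrite rmorphM /= reflects_of_lambda.
Qed.

Lemma divsymm_lambda S F g : divsymm S (F * (g \mPo lambdas p beta)) = divsymm S F * of_lambda g.
Proof. by rewrite /divsymm tofracM mulrAC symm_of_lambda. Qed.

(** (x_j^n - (I_j x_j)^n) / (2 x_j + beta_j) as a polynomial in lambda_j.  Both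
x_j and I_j x_j are roots of X^2 = lambda_j - beta_j X, whence the recurrence. *)
Fixpoint power_quot j n : {mpoly R[p]} :=
  if n is n'.+1 then
    if n' is n''.+1 then 'X_j * power_quot j n'' - (b j)%:MP * power_quot j n' else 1
  else 0.

Lemma power_diff j n :
  x_ j ^+ n - (- x_ j - cst (b j)) ^+ n = (2 * x_ j + cst (b j)) * of_lambda (power_quot j n).
Proof.
elim/ltn_ind: n => [[|[|n]]] IHn.
- by rewrite !expr0 rmorph0 mulr0 subrr.
- by rewrite !expr1 rmorph1; ring.
rewrite rmorphB !rmorphM /= of_lambda_X of_lambda_C.
have -> : (2 * x_ j + cst (b j)) *
    (lam beta j 0 * of_lambda (power_quot j n) - cst (b j) * of_lambda (power_quot j n.+1))
  = lam beta j 0 * ((2 * x_ j + cst (b j)) * of_lambda (power_quot j n))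
    - cst (b j) * ((2 * x_ j + cst (b j)) * of_lambda (power_quot j n.+1)) by ring.
rewrite -!IHn // /lam rmorph0 !addr0 !exprS; ring.
Qed.

Lemma power_quot_deg j n : deg_supp [set: 'I_p] 2 (n%:Z - 1) (power_quot j n).
Proof.
elim/ltn_ind: n => [[|[|n]]] IHn; first exact: deg_supp0.
  exact: deg_supp1.
apply: deg_suppB.
  apply: deg_supp_le (deg_suppM (deg_suppX (in_setT j) (lexx _)) (IHn _ _)) => //.
  by lia.
apply: deg_suppCM; apply: deg_supp_le (IHn n.+1 _) => //; lia.
Qed.

(** The sum over the sign vectors of support S factors over the indices. *)
Lemma divsymm_monomial S (n : 'X_{1..p}) : (forall j, j \notin S -> n j = 0%N) ->
  divsymm S 'X_[n] = of_lambda (\prod_(j in S) power_quot j (n j)).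
Proof.
move=> nS; rewrite rmorph_prod /=.
pose F j (e : 'I_3) := if j \notin S then 1 : K else
  if e == 0 then - ((- x_ j - cst (b j)) ^+ n j / (2 * x_ j + cst (b j)))
  else x_ j ^+ n j / (2 * x_ j + cst (b j)).
pose Q j (e : 'I_3) := (e != 1) == (j \in S).
have termE t : supp t == S ->
  reflects beta (fun i => t i == 0) (tofrac 'X_[n] / \prod_(j in S) (2 * x_ j + cst (b j)))
  = \prod_j F j (t j).
  move=> /eqP tS; rewrite mpolyXE_id rmorph_prod (bigID (fun j => j \in S)) /=.
  rewrite [X in _ * X / _]big1 ?mulr1; last by move=> j /nS ->; rewrite expr0 tofrac1.
  rewrite -prodf_div rmorph_prod [RHS](bigID (fun j => j \in S)) /=.
  rewrite [X in _ = _ * X]big1 ?mulr1; last by move=> j jS; rewrite /F jS.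
  apply: eq_bigr => j jS; rewrite /F jS /= rmorphM fmorphV rmorphD rmorphM /=.
  rewrite rmorph_nat reflects_cst tofracXn rmorphXn /= reflects_x.
  case: ifP => // _; rewrite -mulrN; congr (_ * _).
  by rewrite -invrN; congr (_^-1); ring.
rewrite /divsymm /symm (eq_bigr _ termE).
rewrite (eq_bigl (fun t : {ffun 'I_p -> 'I_3} => t \in family Q)); last first.
  move=> t; apply/eqP/familyP => [tS j|tQ]; first by rewrite unfold_in /Q -tS inE eqxx.
  by apply/setP => j; rewrite inE; have := tQ j; rewrite unfold_in => /eqP.
rewrite -bigA_distr_big_dep [RHS]big_mkcond; apply: eq_bigr => j _.
rewrite /Q /F; case: (boolP (j \in S)) => jS /=.
  rewrite big_mkcond !big_ord_recl big_ord0 /= add0r addr0 -mulNr -mulrDl addrC.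
  by rewrite power_diff mulrC mulKf // lin_neq0.
rewrite (big_pred1 1) // => e; by rewrite /= eqbF_neg negbK.
Qed.

(** The degree is counted in x, so that the bound can have any parity: that of
deg F - |S| for a divided difference of F. *)
Definition halfdeg k f := exists2 g, deg_supp [set: 'I_p] 2 k g & f = of_lambda g.

Lemma divsymm_deg S k F : deg_supp S 1 k F -> halfdeg (k - #|S|%:Z) (divsymm S F).
Proof.
move=> Fk; rewrite (mpolyE F) raddf_sum /=.
exists (\sum_(n <- msupp F) (F@_n)%:MP * \prod_(j in S) power_quot j (n j)); last first.
  rewrite rmorph_sum; apply: eq_big_seq => n /Fk[_ nS] /=.
  by rewrite divsymmZ divsymm_monomial // rmorphM /= of_lambda_C.
rewrite big_seq; apply: big_ind => [|G1 G2|n /Fk[nk nS]].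
- exact: deg_supp0.
- exact: deg_suppD.
apply: deg_suppCM; apply: (deg_supp_le _
  (deg_supp_prod (k := fun j => (n j)%:Z - 1) _)); last first.
  by move=> j _; exact: power_quot_deg.
rewrite sumrB sumr_const -mulr_natl natz mulr1 lerD2r; apply: le_trans nk.
rewrite mul1n mdegE -(big_morph _ PoszD (erefl _)) lez_nat.
by rewrite [leqRHS](bigID (fun j => j \in S)) leq_addr.
Qed.

End Symmetrization.

(** * Numerators of the terms *)
Section Approx.
Variables (R : realType) (p : nat).
Implicit Types (F G : {mpoly R[p]}) (S : {set 'I_p}) (k l : int).

(** Having the same leading terms; see [approxM] for the compatibility with
products. *)
Definition approx S k F F' :=
  deg_supp S 1 k F' /\ deg_supp S 1 (k - 1) (F - F').

Lemma approx_deg S k F F' : approx S k F F' -> deg_supp S 1 k F.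
Proof.
move=> [F'k dk]; rewrite -(subrK F' F); apply: deg_suppD => //.
by apply: deg_supp_le dk; lia.
Qed.

Lemma approxM S k l F F' G G' :
  approx S k F F' -> approx S l G G' -> approx S (k + l) (F * G) (F' * G').
Proof.
move=> aF [G'l dG]; have [F'k dF] := aF; have Fk := approx_deg aF.
split; first exact: deg_suppM.
have -> : F * G - F' * G' = F * (G - G') + (F - F') * G' by ring.
apply: deg_suppD; first by apply: (deg_supp_le _ (deg_suppM Fk dG)); lia.
by apply: (deg_supp_le _ (deg_suppM dF G'l)); lia.
Qed.
End Approx.

Section LeadingTerms.
Variables (R : realType) (p : nat) (beta : nat -> R) (N : R).
Local Notation K := (ratfun R p).
Local Notation b i := (beta i.+1).
Implicit Types (i j : 'I_p) (S : {set 'I_p}) (f h : K) (F G g : {mpoly R[p]}).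
Implicit Types (k l : int) (m : 'I_p -> nat).

Definition lam_poly j : {mpoly R[p]} := 'X_j * ('X_j + (b j)%:MP).

Lemma lam_poly_comp j : lam_poly j = 'X_j \mPo lambdas p beta.
Proof. by rewrite comp_mpolyXU -tnth_nth tnth_mktuple. Qed.

Lemma lam_polyXn_comp j e : lam_poly j ^+ e = 'X_j ^+ e \mPo lambdas p beta.
Proof. by rewrite lam_poly_comp rmorphXn. Qed.

Lemma lam_poly_deg S j : j \in S -> deg_supp S 1 2 (lam_poly j).
Proof.
move=> jS; apply: (deg_suppM (k := 1) (l := 1)); first exact: deg_suppX.
by apply: deg_suppD; [exact: deg_suppX | exact: deg_suppC].
Qed.

Lemma lam_polyXn_deg S j e : j \in S -> deg_supp S 1 (2 * e%:Z) (lam_poly j ^+ e).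
Proof. by move=> jS; apply/deg_suppXn/lam_poly_deg. Qed.

Lemma deg_supp_nat S k n F : deg_supp S 1 k F -> deg_supp S 1 k (n%:R * F).
Proof. by move=> Fk; rewrite -(rmorph_nat (@mpolyC p R)); apply: deg_suppCM. Qed.

Definition lam_deriv j n : {mpoly R[p]} := n%:R * lam_poly j ^+ n.-1.

Lemma lam_deriv_lam j n : lam_poly j * lam_deriv j n = n%:R * lam_poly j ^+ n.
Proof.
rewrite /lam_deriv; case: n => [|n]; first by rewrite !mul0r mulr0.
by rewrite mulrCA -exprS.
Qed.

Lemma lam_deriv_deg S j n : j \in S -> deg_supp S 1 (2 * n%:Z - 2) (lam_deriv j n).
Proof.
move=> jS; case: n => [|n]; first by rewrite /lam_deriv mul0r; apply: deg_supp0.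
rewrite /lam_deriv /=; apply: deg_supp_nat.
by have H := lam_polyXn_deg (e := n) jS; apply: deg_supp_le H; lia.
Qed.

(** Delta_j lambda_j. *)
Definition lam_incr j : {mpoly R[p]} := 2 * 'X_j + (b j)%:MP + 1.

Lemma lam_incr_deg S j : j \in S -> deg_supp S 1 1 (lam_incr j).
Proof.
move=> jS; apply: deg_suppD; last exact: deg_supp1.
by apply: deg_suppD; [apply/deg_supp_nat/deg_suppX | exact: deg_suppC].
Qed.

(** The quotient of Delta_j (lambda_j^n) by Delta_j lambda_j, from the Leibniz
rule for the forward difference. *)
Fixpoint fdiff_quot j n : {mpoly R[p]} :=
  if n is n'.+1 then lam_poly j ^+ n' + (lam_poly j + lam_incr j) * fdiff_quot j n' else 0.

Lemma tofrac_lam_poly j : tofrac (lam_poly j) = lam beta j 0.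
Proof. by rewrite -of_lambda_X lam_poly_comp. Qed.

Lemma tofrac_lam_incr j : tofrac (lam_incr j) = 2 * x_ j + cst (b j) + 1.
Proof. by rewrite /lam_incr !tofracD tofracM tofrac1 (rmorph_nat (@tofrac _)). Qed.

Lemma fdiff_lam_pow j n :
  lam beta j 1 ^+ n - lam beta j 0 ^+ n
  = (2 * x_ j + cst (b j) + 1) * tofrac (fdiff_quot j n).
Proof.
have l1 : lam beta j 1 = lam beta j 0 + tofrac (lam_incr j).
  by rewrite tofrac_lam_incr /lam rmorph1 rmorph0; ring.
rewrite -tofrac_lam_incr; elim: n => [|n IHn].
  by rewrite !expr0 subrr tofrac0 mulr0.
have ll : tofrac (lam_poly j + lam_incr j) = lam beta j 1.
  by rewrite l1 -tofrac_lam_poly tofracD.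
rewrite [fdiff_quot j n.+1]/= [X in _ * X]tofracD tofracM ll tofracXn tofrac_lam_poly.
rewrite [RHS]mulrDr [X in _ = _ + X]mulrCA -IHn l1 !exprS; ring.
Qed.

(** A single divided difference lowers the degree in x by one only, so for
|S| = 1 the two highest degrees of the quotient matter. *)
Lemma fdiff_quot_expand S j n : j \in S ->
  exists2 g, deg_supp S 1 (2 * n%:Z - 2) g &
    fdiff_quot j n.+1 = n.+1%:R * lam_poly j ^+ n + n.+1%:R * 'X_j * lam_deriv j n + g.
Proof.
move=> jS; elim: n => [|n [g gk IHn]].
  by exists 0; [exact: deg_supp0 | rewrite /lam_deriv /= expr0; ring].
have Xd : deg_supp S 1 1 ('X_j : {mpoly R[p]}) by exact: deg_suppX.
have dd := lam_incr_deg jS; have ld := lam_poly_deg jS.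
have Dd := lam_deriv_deg (n := n) jS; have Ld := lam_polyXn_deg (e := n) jS.
exists (lam_poly j * g + ((b j + 1) *+ n.+1)%:MP * lam_poly j ^+ n
        + lam_incr j * (n.+1%:R * ('X_j * lam_deriv j n) + g)).
  apply: deg_suppD; first apply: deg_suppD.
  - by apply: (deg_supp_le _ (deg_suppM ld gk)); lia.
  - by apply: deg_suppCM; apply: deg_supp_le Ld; lia.
  apply: (deg_supp_le _ (deg_suppM dd (_ : deg_supp S 1 (2 * n%:Z - 1) _))).
    by lia.
  apply: deg_suppD; last by apply: deg_supp_le gk; lia.
  by apply: deg_supp_nat; apply: (deg_supp_le _ (deg_suppM Xd Dd)); lia.
rewrite -/(fdiff_quot j n.+1) [LHS]/= -[_ + _ * fdiff_quot j n]/(fdiff_quot j n.+1) IHn.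
rewrite [(lam_poly j + lam_incr j) * _]mulrDl.
have -> : lam_poly j * (n.+1%:R * lam_poly j ^+ n + n.+1%:R * 'X_j * lam_deriv j n + g)
  = n.+1%:R * lam_poly j ^+ n.+1 + n.+1%:R * 'X_j * (n%:R * lam_poly j ^+ n) + lam_poly j * g.
  by rewrite -(lam_deriv_lam j n) exprS; ring.
rewrite [lam_deriv j n.+1]/lam_deriv /= rmorphMn rmorphD rmorph1 /= /lam_incr.
by ring.
Qed.

Lemma fdiff_quot_approx S j n : j \in S -> approx S (2 * n%:Z - 2) (fdiff_quot j n) (lam_deriv j n).
Proof.
move=> jS; split; first exact: lam_deriv_deg.
case: n => [|n]; first by rewrite /lam_deriv mul0r subrr; apply: deg_supp0.
have [g gk ->] := fdiff_quot_expand n jS.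
have -> : n.+1%:R * lam_poly j ^+ n + n.+1%:R * 'X_j * lam_deriv j n + g - lam_deriv j n.+1
  = n.+1%:R * ('X_j * lam_deriv j n) + g by rewrite [lam_deriv j n.+1]/lam_deriv /=; ring.
apply: deg_suppD; last by apply: deg_supp_le gk; lia.
apply: deg_supp_nat.
apply: (deg_supp_le _ (deg_suppM (deg_suppX jS (lexx _)) (lam_deriv_deg (n := n) jS))).
by lia.
Qed.

Definition A_num i1 (s : seq 'I_p) : {mpoly R[p]} :=
  let il := last i1 s in
  ('X_i1 + (b i1)%:MP - (beta 0%N)%:MP) * ('X_i1 + (b i1)%:MP)
  * (\prod_(jk <- zip (i1 :: s) s)
        (('X_jk.2 + 'X_jk.1 + (b jk.2)%:MP) * ('X_jk.2 + 'X_jk.1 + (b jk.2)%:MP + 1)))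
  * ('X_il + (beta p.+1)%:MP + N%:MP) * (N%:MP - 'X_il).

Lemma A_supportE i1 s : A_support beta N i1 s
  = tofrac (A_num i1 s) / (\prod_(k <- i1 :: s) (2 * x_ k + cst (b k))
                           * \prod_(k <- i1 :: s) (2 * x_ k + cst (b k) + 1)).
Proof.
rewrite /A_support /A_num -big_split /=; set D := \prod_(k <- i1 :: s) _.
rewrite !tofracM rmorph_prod /= [in RHS](eq_bigr (fun jk : 'I_p * 'I_p =>
  (x_ jk.2 + x_ jk.1 + cst (b jk.2)) * (x_ jk.2 + x_ jk.1 + cst (b jk.2) + 1))); last first.
  by move=> jk _; rewrite tofracM !tofracD tofrac1.
rewrite !tofracB !tofracD mulrA.
by rewrite ![_ / D * _]mulrAC.
Qed.

Definition support_seq S : seq 'I_p := [seq i <- enum 'I_p | (i \in S : nat) != 0%N].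

Lemma mem_support_seq S : support_seq S =i S.
Proof. by move=> i; rewrite mem_filter mem_enum andbT eqb0 negbK. Qed.

Lemma support_seq_uniq S : uniq (support_seq S).
Proof. exact/filter_uniq/enum_uniq. Qed.

Lemma size_support_seq S : size (support_seq S) = #|S|.
Proof.
by rewrite -(card_uniqP (support_seq_uniq S)); apply: eq_card; apply: mem_support_seq.
Qed.

Lemma big_support_seq (T : Type) (idx : T) (op : Monoid.com_law idx) S (F : 'I_p -> T) :
  \big[op/idx]_(i <- support_seq S) F i = \big[op/idx]_(i in S) F i.
Proof.
rewrite -big_enum; apply: perm_big; apply: uniq_perm; rewrite ?enum_uniq ?support_seq_uniq //.
by move=> i; rewrite mem_support_seq mem_enum.
Qed.

Definition term_num m i1 s : {mpoly R[p]} :=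
  A_num i1 s * \prod_(j <- i1 :: s) fdiff_quot j (m j).

(** Each Delta_j (lambda_j^(m_j)) contributes the factor 2 x_j + beta_j + 1 of
the denominator of A_S. *)
Lemma A_set_fdiff m S i1 s : support_seq S = i1 :: s ->
  A_set beta N S * \prod_(j in S) (lam beta j 1 ^+ m j - lam beta j 0 ^+ m j)
  = tofrac (term_num m i1 s) / \prod_(j in S) (2 * x_ j + cst (b j)).
Proof.
move=> SE; rewrite /A_set /A_nonneg -/(support_seq S) SE A_supportE.
rewrite -!big_support_seq SE /term_num [in RHS]tofracM (rmorph_prod (@tofrac _)).
rewrite (eq_bigr _ (fun j _ => fdiff_lam_pow j (m j))) big_split /=.
rewrite invfM !mulrA divfK; first by rewrite mulrAC.
rewrite prodf_seq_neq0; apply/allP => j _ /=.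
by rewrite -addrA -[1](rmorph1 (@cst R p)) -rmorphD lin_neq0.
Qed.

End LeadingTerms.

(** * Leading terms and triangularity *)
Section HalfDeg.
Variables (R : realType) (p : nat) (beta : nat -> R).
Local Notation K := (ratfun R p).
Implicit Types (f h : K) (k l : int).
Local Notation halfdeg := (@halfdeg R p beta).

Lemma halfdeg_le k l f : k <= l -> halfdeg k f -> halfdeg l f.
Proof. by move=> kl [g gk ->]; exists g => //; apply: deg_supp_le gk. Qed.

Lemma halfdeg0 k : halfdeg k 0.
Proof. by exists 0; [exact: deg_supp0 | rewrite rmorph0]. Qed.

Lemma halfdegD k f h : halfdeg k f -> halfdeg k h -> halfdeg k (f + h).
Proof.
by move=> [F Fk ->] [G Gk ->]; exists (F + G); [exact: deg_suppD | rewrite rmorphD].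
Qed.

Lemma halfdegM k l f h : halfdeg k f -> halfdeg l h -> halfdeg (k + l) (f * h).
Proof.
by move=> [F Fk ->] [G Gk ->]; exists (F * G); [exact: deg_suppM | rewrite rmorphM].
Qed.

Lemma halfdegZ k c f : halfdeg k f -> halfdeg k (cst c * f).
Proof.
move=> [F Fk ->]; exists (c%:MP * F); first exact: deg_suppCM.
by rewrite rmorphM /= of_lambda_C.
Qed.

Lemma halfdeg_sum (I : Type) (r : seq I) (P : pred I) k (f : I -> K) :
  (forall i, P i -> halfdeg k (f i)) -> halfdeg k (\sum_(i <- r | P i) f i).
Proof. by move=> fk; apply: big_ind => //; [exact: halfdeg0 | exact: halfdegD]. Qed.

(** The degree in x of an element of P_lambda is even, so the odd bound drops
the degree in lambda by one. *)
Lemma halfdeg_in_Plambda_deg (d : nat) f :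
  halfdeg (2 * d%:Z - 1) f -> in_Plambda_deg beta (d%:Z - 1) f.
Proof.
move=> [g gk ->]; exists g => //; rewrite subrK lez_nat msizeE.
by apply/bigmax_leqP_seq => n /gk[]; lia.
Qed.

Lemma in_Plambda_deg_halfdeg (d : nat) f :
  in_Plambda_deg beta d%:Z f -> halfdeg (2 * d%:Z) f.
Proof.
move=> [g gd ->]; exists g => // n /msize_mdeg_lt nd.
by split=> [|j]; [lia | rewrite inE].
Qed.

End HalfDeg.

Section Triangular.
Variables (R : realType) (p : nat) (beta : nat -> R) (N : R).
Local Notation K := (ratfun R p).
Local Notation b i := (beta i.+1).
Local Notation halfdeg := (@halfdeg R p beta).
Local Notation divsymm := (divsymm beta).
Local Notation of_lambda := (of_lambda beta).
Local Notation lam_poly := (lam_poly beta).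
Implicit Types (i j : 'I_p) (S : {set 'I_p}) (f h : K) (F G g : {mpoly R[p]}).
Implicit Types (k l : int) (m : 'I_p -> nat).

(** With [divsymm_vars] this evaluates the divided difference of the leading
terms, whose other factors are polynomials in lambda. *)
Lemma divsymm1 S : S != set0 -> divsymm S 1 = 0.
Proof.
move=> /set0Pn[j jS]; rewrite -mpolyX0 divsymm_monomial => [|i _]; last by rewrite mnm0E.
by rewrite (bigD1 j) //= mnm0E mul0r rmorph0.
Qed.

Lemma divsymmCM S c F : divsymm S (c%:MP * F) = cst c * divsymm S F.
Proof. by rewrite mul_mpolyC divsymmZ. Qed.

Lemma divsymm_vars S : divsymm S (\prod_(j in S) 'X_j) = 1.
Proof.
pose n : 'X_{1..p} := [multinom (j \in S : nat) | j < p].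
have -> : \prod_(j in S) 'X_j = 'X_[n] :> {mpoly R[p]}.
  rewrite mpolyXE_id big_mkcond; apply: eq_bigr => j _.
  by rewrite mnmE; case: (j \in S); rewrite ?expr0 ?expr1.
rewrite divsymm_monomial => [|j /negPf jS]; last by rewrite mnmE jS.
by rewrite big1 ?rmorph1 // => j jS; rewrite mnmE jS.
Qed.

Lemma divsymm_approx S k F F' : deg_supp S 1 k (F - F') ->
  halfdeg (k - #|S|%:Z) (divsymm S F - divsymm S F').
Proof. by move=> /(divsymm_deg beta); rewrite raddfB. Qed.

Local Notation gamma := (beta p.+1 - beta 0%N).

(** The coefficient of lambda^m in the contribution of the support S. *)
Definition lead_coefS m S : R :=
  if #|S| == 1%N then \sum_(i in S) - ((m i)%:R * ((m i)%:R - 1 + gamma))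
  else if #|S| == 2 then - (2 * \prod_(i in S) (m i)%:R) else 0.

Local Notation lead_spec m S F := (halfdeg (2 * (\sum_(j in S) m j)%N%:Z - 1)
   (divsymm S F - cst (lead_coefS m S) * of_lambda (\prod_(j in S) 'X_j ^+ m j))).

(** Here A_S is the coefficient of a univariate operator; its numerator is
- lambda_i^2 - (beta_(p+1) - beta_0) x_i lambda_i modulo degree 2.  The terms of
F_S without the factor x_i are killed by the divided difference. *)
Lemma lead_term1 m i : lead_spec m [set i] (term_num beta N m i [::]).
Proof.
rewrite /lead_coefS cards1 !big_set1 /=.
rewrite /term_num big_seq1; set A := A_num _ _ _ _.
case: (m i) => [|n].
  by rewrite [fdiff_quot _ _ 0]/= !mulr0 raddf0 mul0r oppr0 rmorph0 mul0r subr0; apply: halfdeg0.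
have iS := set11 i.
have [g gk ->] := fdiff_quot_expand beta n iS.
have X1 : deg_supp [set i] 1 1 ('X_i : {mpoly R[p]}) by exact: deg_suppX.
have l2 := lam_poly_deg (beta := beta) iS; have ln := lam_polyXn_deg (beta := beta) (e := n) iS.
have dn := lam_deriv_deg (beta := beta) (n := n) iS.
(* c and c' are the constant terms of the two pairs of factors of the numerator
   once x_i^2 is expressed through lambda_i; a collects its terms of degree at
   most 2. *)
pose c := b i ^+ 2 - beta 0%N * b i; pose c' := N ^+ 2 + N * beta p.+1.
pose a : {mpoly R[p]} := (c' - c)%:MP * lam_poly i
  + ((b i - beta 0%N) * (b i - beta p.+1))%:MP * 'X_i ^+ 2
  + ((b i - beta 0%N) * c' + c * (b i - beta p.+1))%:MP * 'X_i + (c * c')%:MP.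
have a2 : deg_supp [set i] 1 2 a.
  apply: deg_suppD; last exact: deg_suppC.
  apply: deg_suppD; last by apply: deg_suppCM; apply: deg_supp_le X1.
  apply: deg_suppD; first exact: deg_suppCM.
  by apply: deg_suppCM; apply: (deg_supp_le _ (deg_suppXn (e := 2) X1)).
have AE : A = - lam_poly i ^+ 2 + (- gamma)%:MP * 'X_i * lam_poly i + a.
  by rewrite /A /A_num big_nil /a /c /c' /lam_poly /=; ring.
have A4 : deg_supp [set i] 1 4 A.
  rewrite AE; apply: deg_suppD; last by apply: deg_supp_le a2.
  apply: deg_suppD; first by apply: deg_suppN; apply: (deg_supp_le _ (deg_suppXn (e := 2) l2)).
  by apply: (deg_supp_le _ (deg_suppM (deg_suppCM X1) l2)).
pose Q : {mpoly R[p]} := (- n.+1%:R)%:MP * lam_poly i ^+ n.+2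
  + (- (n.+1%:R * (n.+1%:R - 1 + gamma)))%:MP * ('X_i * lam_poly i ^+ n.+1).
have DQ : divsymm [set i] Q =
    cst (- (n.+1%:R * (n.+1%:R - 1 + gamma))) * of_lambda ('X_i ^+ n.+1).
  have s0 : [set i] != set0 by apply/set0Pn; exists i.
  have sX : divsymm [set i] 'X_i = 1 by rewrite -(divsymm_vars [set i]) big_set1.
  rewrite /Q raddfD /= [X in X + _]divsymmCM [X in _ + X]divsymmCM.
  rewrite -[lam_poly i ^+ n.+2]mul1r !lam_polyXn_comp !divsymm_lambda divsymm1 // sX.
  by rewrite mul0r mulr0 add0r mul1r.
rewrite -DQ.
have -> : 2 * n.+1%:Z - 1 = 2 * n.+1%:Z - #|[set i]|%:Z :> int by rewrite cards1.
apply: divsymm_approx.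
pose rem : {mpoly R[p]} := ((- gamma) *+ n.+1 * n%:R)%:MP * ('X_i ^+ 2 * lam_poly i ^+ n)
  + a * (n.+1%:R * (lam_poly i ^+ n + 'X_i * lam_deriv beta i n)) + A * g.
have -> : A * (n.+1%:R * lam_poly i ^+ n + n.+1%:R * 'X_i * lam_deriv beta i n + g) - Q = rem.
  rewrite mulrDr [X in X + _ - _](_ : _ =
    - n.+1%:R * lam_poly i ^+ n.+2 + (- gamma)%:MP * n.+1%:R * 'X_i * lam_poly i ^+ n.+1
    + (- lam_poly i + (- gamma)%:MP * 'X_i) * n.+1%:R * 'X_i * (lam_poly i * lam_deriv beta i n)
    + a * (n.+1%:R * (lam_poly i ^+ n + 'X_i * lam_deriv beta i n))).
    by rewrite lam_deriv_lam /Q /rem !exprS; ring.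
  by rewrite AE !exprS; ring.
apply: deg_suppD; first apply: deg_suppD.
- by apply: deg_suppCM; apply: (deg_supp_le _ (deg_suppM (deg_suppXn (e := 2) X1) ln)); lia.
- apply: (deg_supp_le _ (deg_suppM a2 (_ : deg_supp _ _ (2 * n%:Z) _))); first by lia.
  apply: deg_supp_nat; apply: deg_suppD => //.
  by apply: (deg_supp_le _ (deg_suppM X1 dn)); lia.
- by apply: (deg_supp_le _ (deg_suppM A4 gk)); lia.
Qed.

Lemma approx_square S i c c' : i \in S ->
  approx S 2 (('X_i + c%:MP) * ('X_i + c'%:MP)) (lam_poly i).
Proof.
move=> iS; split; first exact: lam_poly_deg.
have X1 : deg_supp S 1 1 ('X_i : {mpoly R[p]}) by exact: deg_suppX.
have -> : ('X_i + c%:MP) * ('X_i + c'%:MP) - lam_poly i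
  = (c + c' - b i)%:MP * 'X_i + (c * c')%:MP by rewrite /lam_poly; ring.
by apply: deg_suppD; [apply: deg_suppCM | apply: deg_suppC].
Qed.

Lemma approxN S k F G : approx S k F G -> approx S k (- F) (- G).
Proof.
move=> [Gk FGk]; split; first exact: deg_suppN.
by rewrite -opprD; apply: deg_suppN.
Qed.

Lemma approx_sum_square S i j c c' : i \in S -> j \in S ->
  approx S 2 (('X_j + 'X_i + c%:MP) * ('X_j + 'X_i + c'%:MP))
             (lam_poly i + lam_poly j + 2 * ('X_i * 'X_j)).
Proof.
move=> iS jS.
have Xi : deg_supp S 1 1 ('X_i : {mpoly R[p]}) by exact: deg_suppX.
have Xj : deg_supp S 1 1 ('X_j : {mpoly R[p]}) by exact: deg_suppX.
split.
  apply: deg_suppD; first by apply: deg_suppD; apply: lam_poly_deg.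
  by apply: deg_supp_nat; apply: (deg_suppM Xi Xj).
have -> : ('X_j + 'X_i + c%:MP) * ('X_j + 'X_i + c'%:MP) -
    (lam_poly i + lam_poly j + 2 * ('X_i * 'X_j))
  = (c + c' - b i)%:MP * 'X_i + (c + c' - b j)%:MP * 'X_j + (c * c')%:MP
  by rewrite /lam_poly; ring.
apply: deg_suppD; last by apply: deg_suppC.
by apply: deg_suppD; apply: deg_suppCM.
Qed.

(** Two divided differences absorb one more degree than one, so the top degree
form is enough: - lambda_i lambda_j (x_i + x_j)^2 times the derivatives, where
x_i^2 = lambda_i and x_j^2 = lambda_j modulo lower degree.  Only the double
product 2 x_i x_j survives. *)
Lemma lead_term2 m i j : i != j -> lead_spec m [set i; j] (term_num beta N m i [:: j]).
Proof.
move=> ij; set S := [set i; j].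
have iS : i \in S by rewrite !inE eqxx.
have jS : j \in S by rewrite !inE eqxx orbT.
have cS : #|S| = 2 by rewrite cards2 ij.
have S0 : S != set0 by apply/set0Pn; exists i.
have bigS (T : Type) (idx : T) (op : Monoid.com_law idx) (f : 'I_p -> T) :
    \big[op/idx]_(k in S) f k = op (f i) (f j).
  by rewrite big_setU1 ?inE // big_set1.
pose Q : {mpoly R[p]} := lam_poly i * (lam_poly i + lam_poly j + 2 * ('X_i * 'X_j)) * (- lam_poly j)
  * (lam_deriv beta i (m i) * lam_deriv beta j (m j)).
have QE : Q = (- ((m i)%:R * (m j)%:R))%:MP *
    (1 * (lam_poly i ^+ (m i).+1 * lam_poly j ^+ m j + lam_poly i ^+ m i * lam_poly j ^+ (m j).+1)
     + 2%:R%:MP * ('X_i * 'X_j * (lam_poly i ^+ m i * lam_poly j ^+ m j))).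
  transitivity (- (lam_poly i + lam_poly j + 2 * ('X_i * 'X_j))
      * ((lam_poly i * lam_deriv beta i (m i)) * (lam_poly j * lam_deriv beta j (m j)))).
    by rewrite /Q; ring.
  by rewrite !lam_deriv_lam !exprS; ring.
have FQ : approx S (2 + 2 + 2 + ((2 * (m i)%:Z - 2) + (2 * (m j)%:Z - 2)))
    (term_num beta N m i [:: j]) Q.
  rewrite /term_num /A_num !big_cons !big_nil !mulr1 /=.
  apply: approxM; last by apply: approxM; apply: fdiff_quot_approx.
  rewrite -mulrA; apply: approxM; first apply: approxM.
  - by rewrite -addrA -rmorphB; apply: approx_square.
  - rewrite -[_ + (b j)%:MP + 1]addrA.
    have -> : (b j)%:MP + 1 = (b j + 1)%:MP :> {mpoly R[p]} by rewrite rmorphD rmorph1.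
    exact: approx_sum_square.
  rewrite -[_ - 'X_j]opprB mulrN; apply: approxN.
  by rewrite -addrA -rmorphD -rmorphN; apply: approx_square.
have -> : cst (lead_coefS m S) * of_lambda (\prod_(k in S) 'X_k ^+ m k) = divsymm S Q.
  have sX : divsymm S ('X_i * 'X_j) = 1 by rewrite -(divsymm_vars S) bigS.
  rewrite QE divsymmCM raddfD /= divsymmCM !lam_polyXn_comp -!rmorphM -rmorphD /=.
  rewrite !divsymm_lambda sX divsymm1 // mul0r add0r mul1r.
  rewrite /lead_coefS cS /= !bigS /= mulrA; congr (_ * _).
  by rewrite -[RHS](rmorphM (@cst R p)) /=; congr cst; ring.
apply: halfdeg_le (divsymm_approx FQ.2).
by rewrite cS bigS /=; lia.
Qed.

Lemma zip_prod_deg S i (s : seq 'I_p) : {subset i :: s <= S} ->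
  deg_supp S 1 (2 * (size s)%:Z)
    (\prod_(jk <- zip (i :: s) s)
       (('X_jk.2 + 'X_jk.1 + (b jk.2)%:MP) * ('X_jk.2 + 'X_jk.1 + (b jk.2)%:MP + 1))).
Proof.
elim: s i => [|j s IHs] i sS; first by rewrite big_nil; apply: deg_supp1.
have iS : deg_supp S 1 1 ('X_i : {mpoly R[p]}).
  by apply: deg_suppX => //; apply: sS; rewrite mem_head.
have jS : deg_supp S 1 1 ('X_j : {mpoly R[p]}).
  by apply: deg_suppX => //; apply: sS; rewrite !inE eqxx orbT.
have sS' : {subset j :: s <= S} by move=> k ks; apply: sS; rewrite inE ks orbT.
have XX : deg_supp S 1 1 ('X_j + 'X_i + (b j)%:MP).
  by apply: deg_suppD; [apply: deg_suppD | apply: deg_suppC].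
have XX1 : deg_supp S 1 1 ('X_j + 'X_i + (b j)%:MP + 1).
  by apply: deg_suppD; last exact: deg_supp1.
rewrite [zip _ _]/= big_cons.
by apply: (deg_supp_le _ (deg_suppM (deg_suppM XX XX1) (IHs j sS'))); rewrite /=; lia.
Qed.

Lemma term_num_deg m S i s : support_seq S = i :: s ->
  deg_supp S 1 (2 * (\sum_(j in S) m j)%N%:Z + 2) (term_num beta N m i s).
Proof.
move=> SE; have sS : {subset i :: s <= S} by move=> k; rewrite -SE mem_support_seq.
have iS : i \in S by apply: sS; rewrite mem_head.
have lS : last i s \in S by apply: sS; rewrite mem_last.
have X1 j : j \in S -> deg_supp S 1 1 ('X_j : {mpoly R[p]}) by move=> jS; exact: deg_suppX.
have Xc (j : 'I_p) (c : R) : j \in S -> deg_supp S 1 1 ('X_j + c%:MP).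
  by move=> jS; apply: deg_suppD; [exact: (X1 _ jS) | exact: deg_suppC].
have Gd : deg_supp S 1 (2 * (\sum_(j in S) m j)%N%:Z - 2 * #|S|%:Z)
    (\prod_(j <- i :: s) fdiff_quot beta j (m j)).
  rewrite -SE big_support_seq.
  apply: (deg_supp_le _ (deg_supp_prod (k := fun j => 2 * (m j)%:Z - 2) _)); last first.
    by move=> j jS; exact: approx_deg (fdiff_quot_approx beta (m j) jS).
  rewrite sumrB -mulr_sumr sumr_const (big_morph Posz PoszD (erefl _)).
  by rewrite -[2 *+ _]mulr_natr (natz #|S|).
have Ad : deg_supp S 1 (2 + 2 * (size s)%:Z + 1 + 1) (A_num beta N i s).
  rewrite /A_num; apply: deg_suppM; first apply: deg_suppM; first apply: deg_suppM.
  - apply: (deg_suppM (k := 1) (l := 1)); last exact: (Xc _ _ iS).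
    by apply: deg_suppB; [exact: (Xc _ _ iS) | exact: deg_suppC].
  - exact: zip_prod_deg.
  - by apply: deg_suppD; [exact: (Xc _ _ lS) | exact: deg_suppC].
  - by apply: deg_suppB; [exact: deg_suppC | exact: (X1 _ lS)].
apply: (deg_supp_le _ (deg_suppM Ad Gd)).
by have := size_support_seq S; rewrite SE /= => <-; lia.
Qed.

(** For three or more indices the degree bound alone suffices. *)
Lemma lead_term m S i s : support_seq S = i :: s -> lead_spec m S (term_num beta N m i s).
Proof.
move=> SE; have sz := size_support_seq S; have mS := mem_support_seq S.
have uS := support_seq_uniq S; rewrite SE in sz mS uS.
case: s SE sz mS uS => [|j [|k s]] SE sz mS uS.
- have -> : S = [set i] by apply/setP => l; rewrite -mS !inE.
  exact: lead_term1.
- have -> : S = [set i; j] by apply/setP => l; rewrite -mS !inE.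
  by apply: lead_term2; move: uS; rewrite /= inE andbT.
rewrite /lead_coefS -sz /= rmorph0 mul0r subr0.
have Fd := term_num_deg (m := m) SE; apply: halfdeg_le (divsymm_deg beta Fd).
by rewrite -sz /=; lia.
Qed.

Lemma sum_two_subsets (T : finType) (f : T -> R) :
  \sum_(S : {set T} | #|S| == 2) 2 * \prod_(i in S) f i
  = (\sum_i f i) ^+ 2 - \sum_i f i ^+ 2.
Proof.
have -> : (\sum_i f i) ^+ 2 - \sum_i f i ^+ 2
    = \sum_(u : T * T | u.1 != u.2) f u.1 * f u.2.
  rewrite expr2 mulr_suml; under eq_bigr do rewrite mulr_sumr.
  rewrite pair_bigA.
  rewrite /= (bigID (fun u : T * T => u.1 == u.2)) /=.
  rewrite [X in X + _ - _](_ : _ = \sum_i f i ^+ 2) 1?addrAC ?subrr ?add0r //.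
  rewrite (reindex (fun i : T => (i, i))) /=.
    by rewrite (eq_bigl xpredT) => [|i]; rewrite ?eqxx //; apply: eq_bigr => i _; rewrite expr2.
  exists fst => [//|[i j]] /eqP /= -> //.
rewrite [RHS](partition_big (fun u : T * T => [set u.1; u.2])
  (fun S : {set T} => #|S| == 2)) /=; last first.
  by move=> [i j] /= ij; rewrite cards2 ij.
apply: eq_bigr => S /cards2P[i [j [ij ->]]].
rewrite (bigD1 (i, j)) /= ?ij ?eqxx // (bigD1 (j, i)) /=; last first.
  by rewrite eq_sym ij setUC eqxx /=; apply: contra ij => /eqP[->].
rewrite [X in _ + (_ + X)]big1 => [|[k l] /= /andP[/andP[/andP[kl /eqP E] n1] n2]].
  by rewrite big_setU1 ?inE // big_set1 /=; ring.
have : k \in [set i; j] by rewrite -E !inE eqxx.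
have : l \in [set i; j] by rewrite -E !inE eqxx orbT.
rewrite !inE => /orP[]/eqP lE /orP[]/eqP kE; subst k l.
- by rewrite eqxx in kl.
- by rewrite eqxx in n2.
- by rewrite eqxx in n1.
- by rewrite eqxx in kl.
Qed.

Lemma sum_lead_coefS m : let d := \sum_i (m i)%:R in
  \sum_(S : {set 'I_p} | S != set0) lead_coefS m S = - (d * (d - 1 + gamma)).
Proof.
move=> d.
have split1 S : lead_coefS m S =
   (if #|S| == 1%N then \sum_(i in S) - ((m i)%:R * ((m i)%:R - 1 + gamma)) else 0)
   - (if #|S| == 2 then 2 * \prod_(i in S) (m i)%:R else 0).
  rewrite /lead_coefS; case: eqP => [->|_] /=; first by rewrite subr0.
  by case: eqP => _; rewrite sub0r ?oppr0.
rewrite big_mkcond (eq_bigr (fun S => lead_coefS m S)) => [|S _]; last first.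
  by case: eqP => // ->; rewrite /lead_coefS cards0.
rewrite (eq_bigr _ (fun S _ => split1 S)) sumrB -!big_mkcond /=.
rewrite (sum_two_subsets (fun i => (m i)%:R)) -/d.
have -> : \sum_(S : {set 'I_p} | #|S| == 1%N)
    \sum_(i in S) - ((m i)%:R * ((m i)%:R - 1 + gamma))
  = \sum_i - ((m i)%:R * ((m i)%:R - 1 + gamma)).
  rewrite [RHS](partition_big (fun i : 'I_p => [set i]) (fun S => #|S| == 1%N)) /=; last first.
    by move=> i _; rewrite cards1.
  apply: eq_bigr => S /cards1P[i ->]; apply: eq_bigl => j.
  by rewrite inE (inj_eq set1_inj).
have -> : \sum_i - ((m i)%:R * ((m i)%:R - 1 + gamma))
  = - (\sum_i (m i)%:R ^+ 2 + (gamma - 1) * d).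
  rewrite /d mulr_sumr -big_split /= -sumrN; apply: eq_bigr => i _; ring.
by ring.
Qed.

Lemma Lop_monomial (n : 'X_{1..p}) :
  halfdeg (2 * (mdeg n)%:Z - 1) (Lop beta N (of_lambda 'X_[n])
    - cst (- ((mdeg n)%:R * ((mdeg n)%:R - 1 + gamma))) * of_lambda 'X_[n]).
Proof.
have evX : of_lambda 'X_[n] = \prod_j lam beta j 0 ^+ n j.
  rewrite mpolyXE_id rmorph_prod; apply: eq_bigr => j _.
  by rewrite /= rmorphXn /= of_lambda_X.
rewrite [in Lop _ _ _]evX Lop_lam.
have -> : (mdeg n)%:R = \sum_i (n i)%:R :> R by rewrite mdegE natr_sum.
rewrite -(sum_lead_coefS n) (rmorph_sum (@cst R p)) /= mulr_suml -sumrB.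
apply: halfdeg_sum => S S0.
case SE : (support_seq S) => [|i s].
  by case/set0Pn: S0 => i; rewrite -mem_support_seq SE.
rewrite (A_set_fdiff beta N n SE) -/(divsymm S _).
have -> : of_lambda 'X_[n]
    = of_lambda (\prod_(j in S) 'X_j ^+ n j) * of_lambda (\prod_(j in ~: S) 'X_j ^+ n j).
  rewrite -rmorphM mpolyXE_id (bigID (fun j => j \in S)) /=; congr (of_lambda (_ * _)).
  by apply: eq_bigl => j; rewrite inE.
have -> : \prod_(j in ~: S) lam beta j 0 ^+ n j = of_lambda (\prod_(j in ~: S) 'X_j ^+ n j).
  by rewrite rmorph_prod; apply: eq_bigr => j _; rewrite /= rmorphXn /= of_lambda_X.
rewrite [cst _ * _]mulrA -mulrBl.
have rest : halfdeg (2 * (\sum_(j in ~: S) n j)%N%:Z) (of_lambda (\prod_(j in ~: S) 'X_j ^+ n j)).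
  exists (\prod_(j in ~: S) 'X_j ^+ n j) => //.
  apply: (deg_supp_le _ (deg_supp_prod (k := fun j => 2 * (n j)%:Z) _)); last first.
    by move=> j _; apply: deg_suppXn; apply: deg_suppX; rewrite ?inE.
  by rewrite -mulr_sumr (big_morph Posz PoszD (erefl _)).
apply: halfdeg_le (halfdegM (lead_term n SE) rest).
have -> : mdeg n = (\sum_(j in S) n j + \sum_(j in ~: S) n j)%N.
  rewrite mdegE (bigID (fun j => j \in S)) /=; congr (_ + _)%N.
  by apply: eq_bigl => j; rewrite inE.
by lia.
Qed.

Lemma Lop_zmod_morphism : zmod_morphism (@Lop R p beta N).
Proof.
have iterB (phi : K -> K) e : zmod_morphism phi -> zmod_morphism (iter e phi).
  by move=> phiB; elim: e => // e IHe f h; rewrite !iterS IHe phiB.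
have bigB (phi : 'I_p -> K -> K) : (forall i, zmod_morphism (phi i)) ->
    zmod_morphism (\big[comp/id]_i phi i).
  move=> phiB; elim/big_ind: _ => // u v uB vB f h /=.
  by rewrite vB uB.
have fB i : zmod_morphism (@fwd_diff R p i) by move=> f h; rewrite /fwd_diff rmorphB; ring.
have bB i : zmod_morphism (@bwd_diff R p i) by move=> f h; rewrite /bwd_diff rmorphB; ring.
move=> f h; rewrite /Lop -sumrB; apply: eq_bigr => t _.
rewrite /fwd_diffs /bwd_diffs bigB; last by move=> i; apply: iterB.
by rewrite bigB ?mulrBr // => i; apply: iterB.
Qed.

Lemma LopZ c f : Lop beta N (cst c * f) = cst c * Lop beta N f.
Proof.
pose scal (phi : K -> K) := forall f, phi (cst c * f) = cst c * phi f.
have iterZ (phi : K -> K) e : scal phi -> scal (iter e phi).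
  by move=> phiZ; elim: e => // e IHe h; rewrite !iterS IHe phiZ.
have bigZ (phi : 'I_p -> K -> K) : (forall i, scal (phi i)) -> scal (\big[comp/id]_i phi i).
  by move=> phiZ; elim/big_ind: _ => // u v uZ vZ h /=; rewrite vZ uZ.
have fZ i : scal (@fwd_diff R p i).
  by move=> h; rewrite /fwd_diff rmorphM /= shift_cst mulrBr.
have bZ i : scal (@bwd_diff R p i).
  by move=> h; rewrite /bwd_diff rmorphM /= shift_cst mulrBr.
rewrite /Lop mulr_sumr; apply: eq_bigr => t _.
rewrite /fwd_diffs /bwd_diffs bigZ; last by move=> i; apply: iterZ.
by rewrite bigZ 1?mulrCA // => i; apply: iterZ.
Qed.

HB.instance Definition _ :=
  GRing.isZmodMorphism.Build K K (@Lop R p beta N) Lop_zmod_morphism.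

(** Monomials of degree less than d may have another eigenvalue, but the difference
of the two eigenvalues multiplies an element of lower degree. *)
Lemma Lop_triangular (d : nat) f : halfdeg (2 * d%:Z) f ->
  halfdeg (2 * d%:Z - 1) (Lop beta N f - cst (- (d%:R * (d%:R - 1 + gamma))) * f).
Proof.
move=> [g gd ->]; rewrite (mpolyE g) rmorph_sum raddf_sum mulr_sumr -sumrB /=.
rewrite big_seq; apply: halfdeg_sum => n /gd[nd _].
rewrite -mul_mpolyC rmorphM /= of_lambda_C LopZ mulrCA -mulrBr.
apply: halfdegZ; set c := cst _.
pose cn : K := cst (- ((mdeg n)%:R * ((mdeg n)%:R - 1 + gamma))).
have -> : Lop beta N (of_lambda 'X_[n]) - c * of_lambda 'X_[n]
  = Lop beta N (of_lambda 'X_[n]) - cn * of_lambda 'X_[n] + (cn - c) * of_lambda 'X_[n] by ring.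
apply: halfdegD; first by apply: halfdeg_le (Lop_monomial n); lia.
have [nE|/eqP n_d] := mdeg n =P d; first by rewrite /cn /c nE subrr mul0r; apply: halfdeg0.
rewrite -rmorphB; apply: halfdegZ; exists 'X_[n] => // l.
by rewrite msuppX inE => /eqP ->; split=> [|j]; [lia | rewrite inE].
Qed.

End Triangular.

Theorem proposition2p4 (R : realType) (p : nat) (p_ge1 : (1 <= p)%N)
    (beta : nat -> R) (N : R) :
  triangular beta (Lop (p := p) beta N) /\
  (forall (d : nat) (q : ratfun R p), in_Plambda_deg beta d%:Z q ->
     eqmod_Plambda beta (d%:Z - 1) (Lop beta N q)
       (cst (- (d%:R * (d%:R - 1 + beta p.+1 - beta 0%N))) * q)).
Proof.
have key (d : nat) (q : ratfun R p) : in_Plambda_deg beta d%:Z q ->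
    eqmod_Plambda beta (d%:Z - 1) (Lop beta N q)
      (cst (- (d%:R * (d%:R - 1 + beta p.+1 - beta 0%N))) * q).
  move=> /in_Plambda_deg_halfdeg/(Lop_triangular N) qd.
  by apply: halfdeg_in_Plambda_deg; rewrite -[_ + _ - _]addrA.
split=> //; split; last by move=> d; eexists; exact: key.
split=> [q [g ->]|c q1 q2 _ _]; last by rewrite raddfD /= LopZ.
(* Preservation of P_lambda follows from the congruence in any degree d that
   bounds the degree of g; the size of g is such a d. *)
have gd : in_Plambda_deg beta (msize g)%:Z (of_lambda beta g).
  by exists g => //; rewrite lez_nat addn1.
have [h _ hE] := key _ _ gd; set c := cst _ in hE.
exists (h + (- ((msize g)%:R * ((msize g)%:R - 1 + beta p.+1 - beta 0%N)))%:MP * g).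
rewrite -[LHS](subrK (c * of_lambda beta g)) hE.
by rewrite -[RHS]/(of_lambda beta (_ + _)) rmorphD rmorphM /= of_lambda_C.
Qed.
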